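(* Let $d\in\mathbb{N}$, $K=\mathbb{N}_0^d$ or $K=\mathbb{Z}^d$, $(\Omega,\mathcal F,P)$ a probability space with a $d$-parameter semigroup (group if $K=\mathbb{Z}^d$) $(\theta_k)_{k\in K}$ of $P$-preserving transformations. Let $M$ be a compact separable metric space with Borel $\sigma$-algebra $\mathcal B$, $\tau:M\to M$ continuous, and $\mu$ a $\tau$-invariant probability measure on $(M,\mathcal B)$ such that $\mu(U)>0$ for every non-empty open $U\subseteq M$. Let $\kappa:M\to K$ be measurable, $\kappa_n=\sum_{i=0}^{n-1}\kappa\circ\tau^i$, $S(t,\omega)=(\tau(t),\theta_{\kappa(t)}\omega)$, $\bar P=\mu\otimes P$, and $\mathcal J$ the $\sigma$-algebra of $S$-invariant sets in $\mathcal B\otimes\mathcal F$. Let $F$ be a $\mathcal B\otimes\mathcal F$-measurable, $\bar P$-integrable function on $M\times\Omega$ with $F(t,\cdot)\in L^1(P)$ for all $t\in M$, such that for every $\omega\in\Omega$ the sequence of functions $$t\mapsto\frac1n\sum_{i=0}^{n-1}F\big(\tau^i(t),\theta_{\kappa_i(t)}\omega\big),\qquad n\in\mathbb{N},$$ is equicontinuous on $M$. Then for $P$-almost all $\omega\in\Omega$, $$\sup_{t\in M}\Big|\frac1n\sum_{i=0}^{n-1}F\big(\tau^i(t),\theta_{\kappa_i(t)}\omega\big)-\bar E[F\mid\mathcal J](t,\omega)\Big|\to0\quad(n\to\infty).$$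
   Context: A semigroup of measure-preserving transformations: each $\theta_k$ measurable and $P$-preserving, $\theta_0=\mathrm{Id}$, $\theta_k\circ\theta_l=\theta_{k+l}$ (and $\theta_{-k}=\theta_k^{-1}$ in the group case). $\bar E[\cdot\mid\mathcal J]$ is conditional expectation w.r.t. $\bar P$. *)

(* Defs.v *)
From HB Require Import structures.
From mathcomp Require Import all_boot all_order all_algebra.
From mathcomp Require Import all_classical all_reals all_analysis.
Set Implicit Arguments. Unset Strict Implicit. Unset Printing Implicit Defensive.
Import Order.TTheory GRing.Theory Num.Theory.
Import numFieldNormedType.Exports.
Local Open Scope classical_set_scope.
Local Open Scope ring_scope.

Notation borel_of M := (g_sigma_algebraType (@open M)).

Definition Kset (grp : bool) (d : nat) : set 'rV[int]_d :=
  if grp then setT else [set k | forall i : 'I_d, (0 <= k ord0 i)%R].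

Definition invariant_sets {dT} {T : measurableType dT} (S : T -> T) : set (set T) :=
  [set A | measurable A /\ S @^-1` A = A].

Definition measurable_wrt {T} {R : realType} (G : set (set T)) (g : T -> R) :=
  forall B : set R, measurable B -> G (g @^-1` B).

Definition is_cond_exp {dT} {T : measurableType dT} {R : realType}
  (mu : {measure set T -> \bar R}) (G : set (set T)) (F g : T -> R) :=
  [/\ measurable_wrt G g,
      mu.-integrable setT (EFin \o g) &
      forall A, G A -> (\int[mu]_(x in A) (g x)%:E = \int[mu]_(x in A) (F x)%:E)%E].

(* Main.v *)
(* The averages in question are the Birkhoff averages of F along the skew product S,
   which preserves the product measure. Birkhoff's theorem is derived from Garsia's
   maximal inequality: the set where the sums of h are unbounded above is strictly
   S-invariant, so h has nonnegative integral over each of its invariant subsets.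
   Applied to F - b and a - F with a < b this makes the set of divergence null;
   applied to F - g + e and g - F + e, where g is the limit, it identifies g as the
   conditional expectation. By Fubini almost every section of the set of convergence
   is conull in M, hence dense because mu charges every open set; equicontinuity and
   compactness then turn convergence on a dense set into uniform convergence. *)
Require Import Defs.
From HB Require Import structures.
From mathcomp Require Import all_boot all_order all_algebra.
From mathcomp Require Import all_classical all_reals all_analysis.
From mathcomp Require Import measurable_realfun.
From mathcomp Require Import ring lra.
Import Order.TTheory GRing.Theory Num.Theory.
Import numFieldNormedType.Exports.
Local Open Scope classical_set_scope.
Local Open Scope ring_scope.

(** * Growth of a real sequence compared with a slope, and convergence of its averages *)

Section averages.
Context {R : realType}.
Implicit Types (s : nat -> R) (b c e l : R).

(** An additive substitute for comparing the limsup of [s n / n] with [b]: true when the limsup is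
    larger, false when it is smaller, undecided at equality. For Birkhoff sums the additive form
    defines a strictly invariant set. *)
Definition exceeds_slope s b := forall c, exists n, c < s n - n%:R * b.

Lemma near_infty_natM_ge c e : 0 < e -> \forall n \near \oo, c <= n%:R * e.
Proof.
move=> e0; exists (Num.Def.archi_bound `|c / e|) => // n /= Hn.
rewrite -ler_pdivrMr// (le_trans (ler_norm _))//.
by rewrite (le_trans (ltW (archi_boundP (normr_ge0 (c / e)))))// ler_nat.
Qed.

Lemma near_average_le s b e : ~ exceeds_slope s b -> 0 < e ->
  \forall n \near \oo, n%:R^-1 * s n <= b + e.
Proof.
move=> /existsNP[c /forallNP Hc] e0; near=> n.
have n0 : (0 < n)%N by near: n; exists 1%N.
have n0' : (0 : R) < n%:R by rewrite ltr0n.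
rewrite ler_pdivrMl// mulrDr; have /negP := Hc n; rewrite -leNgt.
have : c <= n%:R * e by near: n; exact: near_infty_natM_ge.
by lra.
Unshelve. all: by end_near. Qed.

(** If [l < b], then [s n < n * b] from some [N] on, so only finitely many terms can make
    [s n - n * b] positive. *)
Lemma exceeds_slope_le_lim s b l :
  n%:R^-1 * s n @[n --> \oo] --> l -> exceeds_slope s b -> b <= l.
Proof.
move=> sl sb; rewrite leNgt; apply/negP => lb.
have [N _ HN] : \forall n \near \oo, n%:R^-1 * s n < b by exact: cvgr_lt sl _ lb.
(* The sum dominates the indices below [N]. The term at 0 serves the case [N = 0]: since [0^-1 = 0],
   the bound on the average says nothing about [s 0]. *)
have [n] := sb (`|s 0%N| + \sum_(i < N) `|s i - i%:R * b|); apply/negP; rewrite -leNgt.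
have [nN|Nn] := ltnP n N.
  apply: le_trans (ler_norm _) _; rewrite (bigD1 (Ordinal nN))//=.
  rewrite addrCA lerDl addr_ge0//; exact: sumr_ge0.
apply: (@le_trans _ _ `|s 0%N|); last by rewrite lerDl; exact: sumr_ge0.
case: n Nn => [|n] Nn; first by rewrite mul0r subr0 ler_norm.
apply: le_trans (normr_ge0 _); rewrite subr_le0.
by have := HN n.+1 Nn; rewrite /= ltr_pdivrMl ?ltr0n// => /ltW.
Qed.

Lemma lt_lim_exceeds_slope s b l :
  n%:R^-1 * s n @[n --> \oo] --> l -> b < l -> exceeds_slope s b.
Proof.
move=> sl bl c.
have e0 : 0 < (l - b) / 2 by rewrite divr_gt0// subr_gt0.
have bm : (l + b) / 2 < l by lra.
(* Averages above the midpoint of [b] and [l] leave a surplus [n * (l - b) / 2] over [n * b], which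
   outgrows [c]. *)
have [n []] : exists n, [/\ (0 < n)%N, (l + b) / 2 < n%:R^-1 * s n & c + 1 <= n%:R * ((l - b) / 2)].
  apply: (@filter_ex _ \oo); near=> n; split.
  - by near: n; exists 1%N.
  - by near: n; exact: cvgr_gt sl _ bm.
  - by near: n; exact: near_infty_natM_ge.
move=> n0; rewrite ltr_pdivlMl ?ltr0n// => H1 H2; exists n.
have -> : n%:R * b = n%:R * ((l + b) / 2) - n%:R * ((l - b) / 2) by field.
by lra.
Unshelve. all: by end_near. Qed.

(** The limit is the infimum of the slopes that [s] does not exceed. Gaps are taken with rational
    endpoints so that countably many exceptional sets suffice later. *)
Lemma cvg_average s :
  (exists b, ~ exceeds_slope s b) ->
  (exists b, ~ exceeds_slope (fun n => - s n) b) ->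
  (forall p q : rat, (p < q)%R ->
    ~ (exceeds_slope s (ratr q) /\ exceeds_slope (fun n => - s n) (- ratr p))) ->
  cvgn (fun n => n%:R^-1 * s n).
Proof.
move=> ub lb pq.
pose A := [set b | ~ exceeds_slope s b].
have infA : has_inf A.
  (* Eventually the averages are at most [b + 1] and at least [- c - 1], whence [b >= - c - 2]. *)
  split => //; have [c Hc] := lb; exists (- c - 2) => b Ab.
  rewrite leNgt; apply/negP => bc.
  have [n []] : exists n, n%:R^-1 * s n <= b + 1 /\ n%:R^-1 * - s n <= c + 1.
    apply: (@filter_ex _ \oo); near=> n; split.
    - by near: n; exact: near_average_le.
    - by near: n; exact: near_average_le.
  by lra.
apply/cvg_ex; exists (inf A); apply/cvgrPdist_le => e e0.
have [b Ab be] := inf_adherent (divr_gt0 e0 (ltr0Sn _ 1)) infA.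
(* Lying below the infimum, [q] is an exceeded slope. As the gap from [p] to [q] is not crossed, the
   averages eventually stay above [p - e / 2], hence above [inf A - e]. *)
have [q] : exists q : rat, ratr q \in `]inf A - e / 2, inf A[ by apply: rat_in_itvoo; lra.
rewrite in_itv/= => /andP[q1 q2].
have [p] : exists p : rat, ratr p \in `]inf A - e / 2, ratr q[ by apply: rat_in_itvoo; lra.
rewrite in_itv/= => /andP[p1 p2].
have Eq : exceeds_slope s (ratr q).
  apply: contrapT => nE; suff : inf A <= ratr q by lra.
  by apply: ge_inf => //; case: infA.
have nEp : ~ exceeds_slope (fun n => - s n) (- ratr p).
  by move=> Ep; apply: (pq p q) => //; rewrite -(ltr_rat R).
have e2 : 0 < e / 2 by exact: divr_gt0.
near=> n.
have : n%:R^-1 * s n <= b + e / 2 by near: n; exact: near_average_le.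
have : n%:R^-1 * - s n <= - ratr p + e / 2 by near: n; exact: near_average_le.
by rewrite ler_norml => ? ?; apply/andP; split; lra.
Unshelve. all: by end_near. Qed.

End averages.

(** * Birkhoff sums, their running maxima and the set where they are unbounded *)

Section birkhoff_sums.
Context {X : Type} {R : realType} (S : X -> X).
Implicit Types (h : X -> R) (n : nat) (x : X).

Definition birkhoff_sum h n x : R := \sum_(i < n) h (iter i S x).

Lemma birkhoff_sumS h n x :
  birkhoff_sum h n.+1 x = h x + birkhoff_sum h n (S x).
Proof.
rewrite /birkhoff_sum big_ord_recl; congr (_ + _).
by apply: eq_bigr => i _; rewrite -iterSr.
Qed.

(** This is the maximum of the Birkhoff sums of lengths 0 to [n]. The recursion makes the identity
    behind Garsia's argument hold by computation. *)
Fixpoint birkhoff_max h n x : R :=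
  if n is n'.+1 then Num.max 0 (h x + birkhoff_max h n' (S x)) else 0.

Lemma birkhoff_max_ge0 h n x : 0 <= birkhoff_max h n x.
Proof. by case: n => //= n; rewrite le_max lexx. Qed.

Lemma birkhoff_max_leS h n x : birkhoff_max h n x <= birkhoff_max h n.+1 x.
Proof.
elim: n x => [|n IHn] x; first exact: birkhoff_max_ge0.
by rewrite [leLHS]/= [leRHS]/= ge_max le_max lexx/= le_max lerD2l IHn orbT.
Qed.

Lemma birkhoff_max_nd h x : {homo birkhoff_max h ^~ x : n m / (n <= m)%N >-> n <= m}.
Proof. by apply: homo_leq => // [|n]; [exact: le_trans|exact: birkhoff_max_leS]. Qed.

Lemma birkhoff_sum_le_max h n x : birkhoff_sum h n x <= birkhoff_max h n x.
Proof.
elim: n x => [|n IHn] x; first by rewrite /birkhoff_sum big_ord0.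
by rewrite birkhoff_sumS /= le_max lerD2l IHn orbT.
Qed.

(** Thresholds are natural numbers, so that measurability follows from countable operations. *)
Definition birkhoff_unbounded h : set X :=
  [set x | forall k : nat, exists n, k%:R < birkhoff_sum h n x].

Lemma birkhoff_unboundedP h x :
  birkhoff_unbounded h x <-> forall c : R, exists n, c < birkhoff_sum h n x.
Proof.
split=> [H c|H k]; last exact: H.
have [n Hn] := H (Num.Def.archi_bound `|c|); exists n.
apply: le_lt_trans Hn; apply: le_trans (ler_norm c) _.
exact: ltW (archi_boundP (normr_ge0 c)).
Qed.

(** Passing from [x] to [S x] drops one term and shifts the sums by the constant [h x], which does
    not affect unboundedness. *)
Lemma birkhoff_unbounded_invariant h :
  S @^-1` birkhoff_unbounded h = birkhoff_unbounded h.
Proof.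
apply/seteqP; split => x /birkhoff_unboundedP H; apply/birkhoff_unboundedP => c.
  have [n Hn] := H (c - h x); exists n.+1.
  by rewrite birkhoff_sumS; lra.
(* The maximum with 0 excludes the empty sum, so the sum has a first term to split off. *)
have [[|n] Hn] := H (Num.max 0 (c + h x)).
  by move: Hn; rewrite /birkhoff_sum big_ord0 gt_max ltxx.
by exists n; move: Hn; rewrite birkhoff_sumS gt_max => /andP[_]; lra.
Qed.

End birkhoff_sums.

(** * Measure-preserving maps and the maximal ergodic inequality *)

Lemma measurable_gt_set {d} {X : measurableType d} {R : realType} (f : X -> R) (c : R) :
  measurable_fun setT f -> measurable [set x | c < f x].
Proof.
move=> mf; have -> : [set x | c < f x] = setT `&` f @^-1` `]c, +oo[.
  by rewrite setTI; apply/seteqP; split => x /=; rewrite in_itv/= andbT.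
exact: mf.
Qed.

Definition measure_preserving {d} {X : measurableType d} {R : realType}
    (m : {measure set X -> \bar R}) (S : X -> X) :=
  measurable_fun setT S /\ forall A, measurable A -> m (S @^-1` A) = m A.

Section maximal_ergodic.
Context {d} {X : measurableType d} {R : realType}.
Context (m : {measure set X -> \bar R}) (S : X -> X).
Hypothesis mpS : measure_preserving m S.
Implicit Types (h : X -> R) (n : nat) (x : X) (B : set X).

Let mS : measurable_fun setT S := mpS.1.

Lemma ge0_integral_comp (f : X -> \bar R) B : measurable_fun setT f ->
  (forall x, (0 <= f x)%E) -> measurable B -> S @^-1` B = B ->
  (\int[m]_(x in B) f (S x) = \int[m]_(x in B) f x)%E.
Proof.
move=> mf f0 mB SB; rewrite -{1}SB.
rewrite -(@ge0_integral_pushforward _ _ _ _ _ _ mS m B f)//; last exact: measurable_funTS.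
by apply: eq_measure_integral => A mA _; rewrite /= /pushforward; exact: mpS.2.
Qed.

Lemma integrable_comp h : measurable_fun setT h -> m.-integrable setT (EFin \o h) ->
  m.-integrable setT (EFin \o (h \o S)).
Proof.
move=> mh /integrableP[_ ih]; apply/integrableP; split.
  by apply/measurable_EFinP; exact: measurableT_comp mh mS.
rewrite (@ge0_integral_comp (fun x => `|(h x)%:E|%E))//.
by apply: measurableT_comp => //; exact/measurable_EFinP.
Qed.

Lemma measurable_iter n : measurable_fun setT (iter n S).
Proof.
elim: n => [|n IHn]; first exact: measurable_id.
exact: measurableT_comp mS IHn.
Qed.

Lemma measurable_birkhoff_sum h n : measurable_fun setT h ->
  measurable_fun setT (birkhoff_sum S h n).
Proof.
move=> mh; apply: measurable_sum => i.
exact: measurableT_comp mh (measurable_iter i).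
Qed.

Lemma measurable_birkhoff_max h n : measurable_fun setT h ->
  measurable_fun setT (birkhoff_max S h n).
Proof.
move=> mh; elim: n => [|n IHn]; first exact: measurable_cst.
apply: (measurable_maxr (f := cst 0)); first exact: measurable_cst.
by apply: measurable_funD => //; exact: measurableT_comp IHn mS.
Qed.

Lemma integrable_birkhoff_max h n : measurable_fun setT h ->
  m.-integrable setT (EFin \o h) -> m.-integrable setT (EFin \o birkhoff_max S h n).
Proof.
move=> mh ih; elim: n => [|n IHn]; first exact: integrable0.
have /= iS := integrable_comp _ (measurable_birkhoff_max h n mh) IHn.
apply: (le_integrable _ _ _ (integrableD measurableT ih iS)) => //.
  by apply/measurable_EFinP; exact: (measurable_birkhoff_max h n.+1 mh).
move=> x _ /=; rewrite lee_fin (ger0_norm (birkhoff_max_ge0 S h n.+1 x)).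
by rewrite ge_max normr_ge0 ler_norm.
Qed.

Lemma measurable_birkhoff_unbounded h : measurable_fun setT h ->
  measurable (birkhoff_unbounded S h).
Proof.
move=> mh.
have -> : birkhoff_unbounded S h =
    \bigcap_k \bigcup_n [set x | k%:R < birkhoff_sum S h n x].
  apply/seteqP; split => [x H k _|x H k]; first by have [n] := H k; exists n.
  by have [n _] := H k I; exists n.
apply: bigcapT_measurable => k; apply: bigcupT_measurable => n.
by apply: measurable_gt_set; exact: measurable_birkhoff_sum.
Qed.

(* Where [f := birkhoff_max S h n.+1] is positive, [h] is at least [f - f \o S], and
   elsewhere [f - f \o S <= 0]; integrate over the invariant set [B]. *)
Lemma maximal_ergodic_finite h n B : measurable_fun setT h ->
  m.-integrable setT (EFin \o h) -> measurable B -> S @^-1` B = B ->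
  (0 <= \int[m]_(x in B `&` [set x | (0 < birkhoff_max S h n x)%R]) (h x)%:E)%E.
Proof.
move=> mh ih mB SB; case: n => [|n].
  rewrite (_ : _ `&` _ = set0) ?integral_set0//.
  by apply/seteqP; split => x //= -[_]; rewrite ltxx.
set f := birkhoff_max S h n.+1; set E := [set x | _].
have mf : measurable_fun setT f by exact: measurable_birkhoff_max.
have mE : measurable E.
  exact: measurable_gt_set.
have if_ : m.-integrable B (EFin \o f).
  by apply: integrableS (integrable_birkhoff_max h n.+1 mh ih).
have ifS : m.-integrable B (EFin \o (f \o S)).
  apply: integrableS (integrable_comp _ mf _) => //.
  exact: integrable_birkhoff_max.
have ihE : m.-integrable B ((EFin \o h) \_ E).
  apply: (integrableS measurableT) => //.
  by apply/(integrable_mkcond _ mE).1; exact: integrableS ih.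
rewrite integral_mkcondr.
have : (\int[m]_(x in B) (f x)%:E <=
    \int[m]_(x in B) (((EFin \o h) \_ E) x + (f (S x))%:E))%E.
  apply: le_integral => //; first exact: integrableD.
  move=> x _; rewrite patchE; case: ifPn => xE; rewrite -EFinD lee_fin.
    move: xE; rewrite inE /E /= => xE.
    have -> : f x = h x + birkhoff_max S h n (S x).
      by rewrite /f /=; apply/max_r; move: xE; rewrite /f /= lt_max ltxx/= => /ltW.
    by rewrite lerD2l; exact: birkhoff_max_leS.
  rewrite add0r; apply: le_trans (birkhoff_max_ge0 _ _ _ _).
  by move: xE; rewrite notin_setE /E /= => /negP; rewrite -leNgt.
rewrite integralD// (@ge0_integral_comp (EFin \o f))//; last 2 first.
- exact/measurable_EFinP.
- by move=> x; rewrite lee_fin birkhoff_max_ge0.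
by rewrite -leeBlDr ?subee//; exact: integrable_fin_num.
Qed.

(** The sets where [birkhoff_max S h n] is positive increase with [n] and exhaust [B]; dominated
    convergence with bound [|h|] passes to the limit in the finite inequality. *)
Lemma maximal_ergodic h B : measurable_fun setT h ->
  m.-integrable setT (EFin \o h) -> measurable B -> S @^-1` B = B ->
  (forall x, B x -> exists n, 0 < birkhoff_sum S h n x) ->
  (0 <= \int[m]_(x in B) (h x)%:E)%E.
Proof.
move=> mh ih mB SB Bpos.
pose E n := [set x | (0 < birkhoff_max S h n x)%R].
have mE n : measurable (E n).
  by apply: measurable_gt_set; exact: measurable_birkhoff_max.
have [| | | |//|_ _ cv] := @dominated_convergence _ _ _ m B mB
  (fun n => (EFin \o h) \_ (E n)) (EFin \o h) (fun x => `|(h x)%:E|%E).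
- move=> n; apply: measurable_funTS; apply/(measurable_restrictT _ (mE n)).1.
  by apply: measurable_funTS; exact/measurable_EFinP.
- by apply: measurable_funTS; exact/measurable_EFinP.
- apply: aeW => x Bx; have [n Hn] := Bpos x Bx.
  apply: cvg_near_cst; exists n => // k /= nk.
  rewrite patchE mem_set// /E /=; apply: lt_le_trans Hn _.
  exact: le_trans (birkhoff_sum_le_max _ _ _ _) (birkhoff_max_nd _ _ _ _ _ nk).
- by apply: integrable_abse; exact: integrableS ih.
- apply: aeW => x n _; rewrite patchE; case: ifP => //=.
  by rewrite normr0 lee_fin.
apply: (cvge_ge _ cv); apply: nearW => n /=.
by rewrite -integral_mkcondr; exact: maximal_ergodic_finite.
Qed.

End maximal_ergodic.

(** * Birkhoff averages, their limit and its invariance *)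

Section birkhoff_limit.
Context {X : Type} {R : realType} (S : X -> X) (F : X -> R).
Implicit Types (n : nat) (x : X).

Definition birkhoff_avg n x : R := n%:R^-1 * birkhoff_sum S F n x.

Definition birkhoff_cvg : set X := [set x | cvgn (birkhoff_avg ^~ x)].

(** The default 0 is placed on an invariant set, so the limit is invariant at every point and not
    only almost everywhere. *)
Definition birkhoff_lim x : R :=
  if x \in birkhoff_cvg then limn (birkhoff_avg ^~ x) else 0.

Lemma birkhoff_limP x : birkhoff_cvg x ->
  birkhoff_avg n x @[n --> \oo] --> birkhoff_lim x.
Proof. by move=> Cx; rewrite /birkhoff_lim mem_set. Qed.

Lemma birkhoff_limE x (l : R) : birkhoff_avg n x @[n --> \oo] --> l -> birkhoff_lim x = l.
Proof.
move=> xl; have Cx : birkhoff_cvg x by apply/cvg_ex; exists l.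
by apply: cvg_unique xl; first exact: norm_hausdorff; exact: birkhoff_limP.
Qed.

(** Each average at [x] is an affine function of one at [S x], and conversely, with coefficients
    tending to 1 and 0. *)
Lemma cvg_birkhoff_avgS x (l : R) :
  birkhoff_avg n (S x) @[n --> \oo] --> l <-> birkhoff_avg n x @[n --> \oo] --> l.
Proof.
have inv0 : (n.+1%:R^-1 : R) @[n --> \oo] --> (0 : R) by exact: cvg_harmonic.
have ratio : (1 + n.+1%:R^-1 : R) @[n --> \oo] --> (1 : R).
  suff : (1 + n.+1%:R^-1 : R) @[n --> \oo] --> (1 + 0 : R) by rewrite addr0.
  by apply: cvgD => //; exact: cvg_cst.
split=> xl.
  rewrite -(cvg_shiftS (birkhoff_avg ^~ x)).
  have -> : (fun n => birkhoff_avg n.+1 x) =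
      (fun n => n.+1%:R^-1 * F x + (1 - n.+1%:R^-1) * birkhoff_avg n (S x)).
    apply/funext => -[|n]; rewrite /birkhoff_avg birkhoff_sumS.
      by rewrite /birkhoff_sum !big_ord0 addr0 !mulr0 addr0.
    rewrite mulrDr; congr (_ + _); rewrite mulrA; congr (_ * _).
    have : (n.+1%:R : R) != 0 by rewrite pnatr_eq0.
    have : (n.+2%:R : R) != 0 by rewrite pnatr_eq0.
    by rewrite -!natr1 => ? ?; field; apply/andP; split.
  have -> : l = 0 * F x + (1 - 0) * l by ring.
  apply: cvgD; first by apply: cvgM => //; exact: cvg_cst.
  by apply: cvgM => //; apply: cvgB => //; exact: cvg_cst.
(* The index is shifted so that the ratio [(n + 2) / (n + 1)] has a nonzero denominator. *)
rewrite -(cvg_shiftS (birkhoff_avg ^~ (S x))).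
have -> : (fun n => birkhoff_avg n.+1 (S x)) =
    (fun n => (1 + n.+1%:R^-1) * birkhoff_avg n.+2 x - n.+1%:R^-1 * F x).
  apply/funext => n; rewrite /birkhoff_avg [in RHS]birkhoff_sumS.
  have : (n.+1%:R : R) != 0 by rewrite pnatr_eq0.
  have : (n.+2%:R : R) != 0 by rewrite pnatr_eq0.
  by rewrite -!natr1 => ? ?; field; apply/andP; split.
have -> : l = 1 * l - 0 * F x by ring.
apply: cvgB; last by apply: cvgM => //; exact: cvg_cst.
apply: cvgM => //.
have := xl; rewrite -(cvg_shiftS (birkhoff_avg ^~ x)).
by rewrite -(cvg_shiftS (fun n => birkhoff_avg n.+1 x)).
Qed.

Lemma birkhoff_cvg_invariant : S @^-1` birkhoff_cvg = birkhoff_cvg.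
Proof.
by apply/seteqP; split => x /cvg_ex[l xl]; apply/cvg_ex; exists l;
  exact/cvg_birkhoff_avgS.
Qed.

Lemma birkhoff_lim_invariant x : birkhoff_lim (S x) = birkhoff_lim x.
Proof.
have [Cx|nCx] := pselect (birkhoff_cvg x).
  exact/birkhoff_limE/cvg_birkhoff_avgS/birkhoff_limP.
rewrite /birkhoff_lim !memNset//; move: nCx; rewrite -{1}birkhoff_cvg_invariant//.
Qed.

Lemma birkhoff_lim_iter i x : birkhoff_lim (iter i S x) = birkhoff_lim x.
Proof. by elim: i => //= i IHi; rewrite birkhoff_lim_invariant. Qed.

(** Along the orbit [g] is constant, so subtracting it lowers the sum of length [n] by [n * g x].
    This serves both constants and the limit shifted by a constant. *)
Lemma birkhoff_unbounded_exceeds (g : X -> R) x : (forall i, g (iter i S x) = g x) ->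
  birkhoff_unbounded S (F \- g) x <-> exceeds_slope (birkhoff_sum S F ^~ x) (g x).
Proof.
move=> gx; rewrite birkhoff_unboundedP.
have E n : birkhoff_sum S (F \- g) n x = birkhoff_sum S F n x - n%:R * g x.
  rewrite /birkhoff_sum sumrB; congr (_ - _).
  by under eq_bigr do rewrite gx; rewrite sumr_const card_ord mulr_natl.
by split => H c; have [n Hn] := H c; exists n; move: Hn; rewrite E.
Qed.

End birkhoff_limit.

Lemma birkhoff_sumN {X : Type} {R : realType} (S : X -> X) (F : X -> R) n x :
  birkhoff_sum S (\- F) n x = - birkhoff_sum S F n x.
Proof. by rewrite /birkhoff_sum sumrN. Qed.

Lemma birkhoff_unboundedN {X : Type} {R : realType} (S : X -> X) (F g : X -> R) x :
  (forall i, g (iter i S x) = g x) ->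
  birkhoff_unbounded S (\- F \- g) x <->
  exceeds_slope (fun n => - birkhoff_sum S F n x) (g x).
Proof.
move=> gx; rewrite birkhoff_unbounded_exceeds//.
by rewrite (_ : (birkhoff_sum _ _)^~ _ = fun n => - birkhoff_sum S F n x)//;
  apply/funext => n; rewrite birkhoff_sumN.
Qed.

(** * Decomposition of the set of divergence *)

Section birkhoff_cvg_complement.
Context {X : Type} {R : realType} (S : X -> X).
Implicit Types (n : nat) (x : X).

(* [unpickle] enumerates the pairs of rationals: for [p < q] the averages drop to
   [p] and rise to [q] infinitely often. *)
Definition crossing (F : X -> R) (k : nat) : set X :=
  match unpickle k : option (rat * rat) with
  | Some (p, q) => if p < q then
      birkhoff_unbounded S (F \- cst (ratr q)) `&`
      birkhoff_unbounded S (\- F \- cst (- ratr p)) else set0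
  | None => set0 end.

(** Averages diverge because they are unbounded above, unbounded below, or oscillate across a
    rational gap. Each cause is a countable combination of sets of unbounded sums. *)
Lemma birkhoff_cvgC (F : X -> R) : ~` birkhoff_cvg S F =
  \bigcap_n birkhoff_unbounded S (F \- cst n%:R) `|`
  \bigcap_n birkhoff_unbounded S (\- F \- cst n%:R) `|`
  \bigcup_k crossing F k.
Proof.
apply/seteqP; split => x; last first.
  move=> H; rewrite /setC /= => /cvg_ex[/= l xl].
  have xN : n%:R^-1 * - birkhoff_sum S F n x @[n --> \oo] --> - l.
    rewrite (_ : (fun n => _) = (fun n => - birkhoff_avg S F n x)).
      exact: cvgN.
    by apply/funext => n; rewrite /birkhoff_avg mulrN.
  have nl (c : R) : ~ forall n, n%:R <= c.
    move=> /(_ (Num.Def.archi_bound `|c|)); apply/negP; rewrite -ltNge.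
    exact: le_lt_trans (ler_norm c) (archi_boundP (normr_ge0 c)).
  case: H => [[H|H]|[k _]].
  - apply: (nl l) => n; apply: exceeds_slope_le_lim xl _.
    by have /birkhoff_unbounded_exceeds := H n I; exact.
  - apply: (nl (- l)) => n; apply: exceeds_slope_le_lim xN _.
    by have /birkhoff_unboundedN := H n I; exact.
  - rewrite /crossing; case: unpickle => [[p q]|//]; case: ifPn => // pq [].
    move=> /birkhoff_unbounded_exceeds => /(_ (fun=> erefl)) /= /(exceeds_slope_le_lim _ _ _ xl) h1.
    move=> /birkhoff_unboundedN => /(_ (fun=> erefl)) /= /(exceeds_slope_le_lim _ _ _ xN) h2.
    have : (ratr p : R) < ratr q by rewrite ltr_rat.
    by lra.
apply: contra_notP => /not_orP[/not_orP[H1 H2] H3].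
apply: cvg_average.
- move/existsNP : H1 => [n /not_implyP[_ Hn]]; exists n%:R.
  by move=> /(birkhoff_unbounded_exceeds S F (cst n%:R)) => /(_ (fun=> erefl)).
- move/existsNP : H2 => [n /not_implyP[_ Hn]]; exists n%:R.
  by move=> /(birkhoff_unboundedN S F (cst n%:R)) => /(_ (fun=> erefl)).
- move=> p q pq [h1 h2]; apply: H3; exists (pickle (p, q)); first exact: I.
  rewrite /crossing pickleK pq; split.
    exact/birkhoff_unbounded_exceeds.
  exact/birkhoff_unboundedN.
Qed.

End birkhoff_cvg_complement.

(** * Birkhoff's theorem for a finite measure *)

Section birkhoff_theorem.
Context {d} {X : measurableType d} {R : realType}.
Context (m : {measure set X -> \bar R}) (S : X -> X).
Hypothesis mpS : measure_preserving m S.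
Hypothesis mfin : (m setT < +oo)%E.
Implicit Types (n : nat) (x : X) (B : set X).

Let mS : measurable_fun setT S := mpS.1.

Lemma finite_measure_fin_num B : measurable B -> m B \is a fin_num.
Proof.
move=> mB; rewrite ge0_fin_numE//.
by apply: le_lt_trans mfin; rewrite le_measure ?inE//; exact: measurableT.
Qed.

Lemma integrable_cst (c : R) : m.-integrable setT (EFin \o cst c).
Proof.
apply/integrableP; split; first exact/measurable_EFinP.
rewrite (_ : (fun x => _) = cst `|c|%:E)// integral_cst//.
by rewrite -ge0_fin_numE ?fin_numM ?finite_measure_fin_num// mule_ge0.
Qed.

(** Sums of [F - g] unbounded above are somewhere positive, so the maximal inequality applies to
    [F - g] on [B]. *)
Lemma le_integral_unbounded (F g : X -> R) B :
  measurable_fun setT F -> m.-integrable setT (EFin \o F) ->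
  measurable_fun setT g -> m.-integrable setT (EFin \o g) ->
  measurable B -> S @^-1` B = B -> B `<=` birkhoff_unbounded S (F \- g) ->
  (\int[m]_(x in B) (g x)%:E <= \int[m]_(x in B) (F x)%:E)%E.
Proof.
move=> mF iF mg ig mB SB BE.
have iFB : m.-integrable B (EFin \o F) by exact: integrableS iF.
have igB : m.-integrable B (EFin \o g) by exact: integrableS ig.
have : (0 <= \int[m]_(x in B) ((F \- g) x)%:E)%E.
  apply: (@maximal_ergodic _ _ _ m S mpS) => //.
  - exact: measurable_funB.
  - exact: (integrableB measurableT iF ig).
  - by move=> x /BE /(_ 0%N).
rewrite (_ : (fun x => ((F \- g) x)%:E) = (fun x => (F x)%:E - (g x)%:E)%E)//.
by rewrite integralB_EFin// sube_ge0// (integrable_fin_num mB igB).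
Qed.

Lemma le_cst_integral_unbounded (F : X -> R) (b : R) B :
  measurable_fun setT F -> m.-integrable setT (EFin \o F) ->
  measurable B -> S @^-1` B = B -> B `<=` birkhoff_unbounded S (F \- cst b) ->
  (b%:E * m B <= \int[m]_(x in B) (F x)%:E)%E.
Proof.
move=> mF iF mB SB BE; rewrite -integral_cst//.
by apply: le_integral_unbounded => //; exact: integrable_cst.
Qed.

(** On this invariant set [B] the integral of [F] is at least [b * m B] and at most [a * m B]. *)
Lemma null_crossing (F : X -> R) (a b : R) : a < b ->
  measurable_fun setT F -> m.-integrable setT (EFin \o F) ->
  m (birkhoff_unbounded S (F \- cst b) `&`
     birkhoff_unbounded S (\- F \- cst (- a))) = 0.
Proof.
move=> ab mF iF; set B := _ `&` _.
have mNF : measurable_fun setT (\- F) by exact: measurableT_comp.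
have iNF : m.-integrable setT (EFin \o (\- F)) by exact: (integrableN iF).
have mB : measurable B.
  apply: measurableI; apply: (measurable_birkhoff_unbounded m) => //.
    by apply: measurable_funB => //; exact: measurable_cst.
  by apply: measurable_funB => //; exact: measurable_cst.
have SB : S @^-1` B = B by rewrite /B preimage_setI !birkhoff_unbounded_invariant.
have h1 := le_cst_integral_unbounded F b B mF iF mB SB (@subIsetl _ _ _).
have h2 := le_cst_integral_unbounded (\- F) (- a) B mNF iNF mB SB (@subIsetr _ _ _).
have iFB : m.-integrable B (EFin \o F) by exact: integrableS iF.
move: h2; rewrite (_ : (fun x => ((\- F) x)%:E) = (fun x => - (F x)%:E)%E)//.
rewrite (integralN (integrable_add_def mB iFB)).
move: h1.
have /fineK <- := integrable_fin_num mB iFB.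
have /fineK <- := finite_measure_fin_num B mB.
rewrite -EFinN -!EFinM !lee_fin => h1 h2; congr EFin.
apply/eqP; rewrite eq_le fine_ge0// andbT; rewrite leNgt; apply/negP => h3.
have : (b - a) * fine (m B) <= 0 by rewrite mulrBl; lra.
by rewrite leNgt mulr_gt0// subr_gt0.
Qed.

(** The finite integral of [F] over this set bounds [n] times its measure for every [n]. *)
Lemma null_unbounded (F : X -> R) :
  measurable_fun setT F -> m.-integrable setT (EFin \o F) ->
  m (\bigcap_n birkhoff_unbounded S (F \- cst n%:R)) = 0.
Proof.
move=> mF iF; set B := \bigcap_n _.
have mB : measurable B.
  apply: bigcapT_measurable => n; apply: (measurable_birkhoff_unbounded m) => //.
  by apply: measurable_funB => //; exact: measurable_cst.
have SB : S @^-1` B = B.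
  by rewrite /B preimage_bigcap; apply: eq_bigcapr => n _; rewrite birkhoff_unbounded_invariant.
have iFB : m.-integrable B (EFin \o F) by exact: integrableS iF.
have h n : (n%:R%:E * m B <= \int[m]_(x in B) (F x)%:E)%E.
  by apply: le_cst_integral_unbounded => // x; exact.
move: h.
have /fineK <- := integrable_fin_num mB iFB.
have /fineK <- := finite_measure_fin_num B mB.
move=> h; congr EFin; apply/eqP; rewrite eq_le fine_ge0// andbT leNgt; apply/negP => h3.
have [n _ Hn] := near_infty_natM_ge (fine (\int[m]_(x in B) (EFin \o F) x)%E + 1) _ h3.
have := h n; rewrite -EFinM lee_fin.
by have := Hn n (leqnn n) => /=; rewrite /comp; lra.
Qed.

(** * Almost sure convergence, and the limit as conditional expectation *)

Section limit.
Context (F : X -> R).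
Hypothesis mF : measurable_fun setT F.
Hypothesis iF : m.-integrable setT (EFin \o F).

Let mNF : measurable_fun setT (\- F).
Proof. exact: measurableT_comp. Qed.

Let iNF : m.-integrable setT (EFin \o (\- F)).
Proof. exact: (integrableN iF). Qed.

Let mE (f : X -> R) (c : R) : measurable_fun setT f ->
  measurable (birkhoff_unbounded S (f \- cst c)).
Proof.
move=> mf; apply: (measurable_birkhoff_unbounded m) => //.
by apply: measurable_funB => //; exact: measurable_cst.
Qed.

Let mcrossing k : measurable (crossing S F k).
Proof.
rewrite /crossing; case: unpickle => [[p q]|]; last exact: measurable0.
by case: ifP => _; [apply: measurableI; exact: mE|exact: measurable0].
Qed.

Lemma measurable_birkhoff_cvg : measurable (birkhoff_cvg S F).
Proof.
rewrite -[birkhoff_cvg _ _]setCK birkhoff_cvgC; apply: measurableC.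
apply: measurableU; last exact: bigcupT_measurable.
by apply: measurableU; apply: bigcapT_measurable => n; exact: mE.
Qed.

Lemma birkhoff_cvg_ae : m (~` birkhoff_cvg S F) = 0.
Proof.
rewrite birkhoff_cvgC; apply: null_set_setU.
- by apply: measurableU; apply: bigcapT_measurable => n; exact: mE.
- exact: bigcupT_measurable.
- apply: null_set_setU.
  + by apply: bigcapT_measurable => n; exact: mE.
  + by apply: bigcapT_measurable => n; exact: mE.
  + exact: null_unbounded.
  + exact: null_unbounded.
- have : m.-negligible (\bigcup_k crossing S F k).
    apply: negligible_bigcup => k; exists (crossing S F k); split => //.
    rewrite /crossing; case: unpickle => [[p q]|]; last exact: measure0.
    case: ifP => pq; last exact: measure0.
    by apply: null_crossing => //; rewrite ltr_rat.
  by move/measure_negligible; apply; exact: bigcupT_measurable.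
Qed.

Lemma measurable_birkhoff_avg n : measurable_fun setT (birkhoff_avg S F n).
Proof.
apply: measurable_funM; first exact: measurable_cst.
exact: (measurable_birkhoff_sum m).
Qed.

Lemma measurable_birkhoff_lim : measurable_fun setT (birkhoff_lim S F).
Proof.
have mC := measurable_birkhoff_cvg.
have -> : birkhoff_lim S F = (birkhoff_lim S F) \_ (birkhoff_cvg S F).
  by apply/funext => x; rewrite patchE /birkhoff_lim; case: ifP.
apply/(measurable_restrictT _ mC).1.
apply: (measurable_fun_cvg (h := birkhoff_avg S F)) => [n|x Cx].
  exact: measurable_funTS (measurable_birkhoff_avg n).
exact: birkhoff_limP.
Qed.

Lemma measurable_wrt_birkhoff_lim : measurable_wrt (invariant_sets S) (birkhoff_lim S F).
Proof.
move=> B mB; split.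
  by rewrite -[_ @^-1` _]setTI; exact: measurable_birkhoff_lim.
by apply/seteqP; split => x /=; rewrite birkhoff_lim_invariant.
Qed.

(** By invariance each of the [n] terms has the same integral. This bounds the averages in L1
    uniformly in [n]. *)
Lemma integral_birkhoff_sum_norm n B : measurable B -> S @^-1` B = B ->
  (\int[m]_(x in B) (birkhoff_sum S (fun y => `|F y|) n x)%:E =
   n%:R%:E * \int[m]_(x in B) `|(F x)%:E|)%E.
Proof.
move=> mB SB.
have mnF : measurable_fun setT (fun y => `|F y|) by exact: measurableT_comp.
have ms k : measurable_fun setT (EFin \o birkhoff_sum S (fun y => `|F y|) k).
  by apply/measurable_EFinP; exact: (measurable_birkhoff_sum m).
have s0 k x : (0 <= (birkhoff_sum S (fun y => `|F y|) k x)%:E)%E.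
  by rewrite lee_fin; exact: sumr_ge0.
elim: n => [|n IHn].
  by rewrite mul0e integral0_eq// => x _; rewrite /birkhoff_sum big_ord0.
under eq_integral do rewrite birkhoff_sumS EFinD.
rewrite ge0_integralD//; last 2 first.
- by apply: measurable_funTS; exact/measurable_EFinP.
- by apply: measurable_funTS; exact: measurableT_comp (ms n) mS.
rewrite (@ge0_integral_comp _ _ _ m S mpS (EFin \o birkhoff_sum S (fun y => `|F y|) n))//; last exact: s0.
rewrite IHn -nat1r EFinD ge0_muleDl ?lee_fin//; congr (_ + _)%E.
by rewrite mul1e.
Qed.

(** Fatou's lemma on the set of convergence, where the averages have L1 norm at most that of [F]. *)
Lemma integrable_birkhoff_lim : m.-integrable setT (EFin \o birkhoff_lim S F).
Proof.
have mC := measurable_birkhoff_cvg; set C := birkhoff_cvg S F in mC *.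
have mg := measurable_birkhoff_lim.
have -> : EFin \o birkhoff_lim S F = (EFin \o birkhoff_lim S F) \_ C.
  by apply/funext => x; rewrite patchE /= /birkhoff_lim /C; case: ifP.
apply/(integrable_mkcond _ mC).1; apply/integrableP; split.
  by apply: measurable_funTS; exact/measurable_EFinP.
have mav n : measurable_fun C (fun x => `|(birkhoff_avg S F n x)%:E|%E).
  apply: measurableT_comp => //; apply: measurable_funTS.
  by apply/measurable_EFinP; exact: measurable_birkhoff_avg.
have avF n : (\int[m]_(x in C) `|(birkhoff_avg S F n x)%:E| <=
              \int[m]_(x in C) `|(F x)%:E|)%E.
  apply: (@le_trans _ _ (\int[m]_(x in C)
    ((n%:R^-1)%:E * (birkhoff_sum S (fun y => `|F y|) n x)%:E))%E).
    apply: ge0_le_integral => //.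
    - apply: measurable_funTS; apply/measurable_EFinP; apply: measurable_funM.
        exact: measurable_cst.
      by apply: (measurable_birkhoff_sum m) => //; exact: measurableT_comp.
    - move=> x _; rewrite -EFinM lee_fin normrM ger0_norm ?invr_ge0//.
      by rewrite ler_wpM2l ?invr_ge0//; exact: ler_norm_sum.
  rewrite ge0_integralZl ?lee_fin ?invr_ge0//; last 2 first.
  - apply: measurable_funTS; apply/measurable_EFinP.
    by apply: (measurable_birkhoff_sum m) => //; exact: measurableT_comp.
  - by move=> x _; rewrite lee_fin; exact: sumr_ge0.
  rewrite integral_birkhoff_sum_norm//; last exact: birkhoff_cvg_invariant.
  (* At [n = 0] the convention [0^-1 = 0] makes the average vanish. *)
  rewrite muleA -EFinM; case: n => [|n].
    by rewrite mulr0 mul0e integral_ge0.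
  by rewrite mulVf ?pnatr_eq0// mul1e.
have intFC : (\int[m]_(x in C) `|(F x)%:E| < +oo)%E.
  by have /integrableP[] : m.-integrable C (EFin \o F) by exact: integrableS iF.
apply: le_lt_trans intFC.
rewrite (eq_integral (fun x => limn_einf (fun n => `|(birkhoff_avg S F n x)%:E|%E))); last first.
  move=> x; rewrite inE => Cx.
  have xl : `|(birkhoff_avg S F n x)%:E|%E @[n --> \oo] --> `|(birkhoff_lim S F x)%:E|%E.
    by apply: cvg_abse; apply: cvg_EFin; [exact: nearW|exact: birkhoff_limP].
  by rewrite (cvg_limn_einf_sup xl).1.
apply: le_trans (fatou m mC mav _) _ => //.
rewrite limn_einf_lim; apply: lime_le; first exact: is_cvg_einfs.
apply: nearW => n; apply: le_trans (avF n).
by apply: ereal_inf_lbound; exists n => /=.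
Qed.

(** Up to a null set, an invariant set lies inside the set of convergence. There the averages of [F]
    tend to a limit above [g - e], with [g] the limit, so the sums of [F - (g - e)] are unbounded;
    likewise for [- F] and [- g]. *)
Theorem birkhoff_cond_exp : is_cond_exp m (invariant_sets S) F (birkhoff_lim S F).
Proof.
have mC := measurable_birkhoff_cvg; set C := birkhoff_cvg S F in mC.
have mg := measurable_birkhoff_lim; have ig := integrable_birkhoff_lim.
split; [exact: measurable_wrt_birkhoff_lim|exact: ig|].
move=> A [mA SA].
have mCc : measurable (~` C) by exact: measurableC.
have AC : A `\` ~` C = A `&` C by rewrite setDE setCK.
rewrite (negligible_integral mCc mA _ birkhoff_cvg_ae); last exact: integrableS ig.
rewrite [RHS](negligible_integral mCc mA _ birkhoff_cvg_ae); last exact: integrableS iF.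
rewrite AC; set B := A `&` C.
have mB : measurable B by exact: measurableI.
have SB : S @^-1` B = B by rewrite /B preimage_setI SA /C birkhoff_cvg_invariant.
have igB : m.-integrable B (EFin \o birkhoff_lim S F) by exact: integrableS ig.
have iFB : m.-integrable B (EFin \o F) by exact: integrableS iF.
have icB c : m.-integrable B (EFin \o cst c).
  by apply: (integrableS measurableT) => //; exact: integrable_cst.
have key (f g : X -> R) : measurable_fun setT f -> m.-integrable setT (EFin \o f) ->
    measurable_fun setT g -> m.-integrable setT (EFin \o g) ->
    (forall e, 0 < e -> B `<=` birkhoff_unbounded S (f \- (g \- cst e))) ->
    (\int[m]_(x in B) (g x)%:E <= \int[m]_(x in B) (f x)%:E)%E.
  move=> mf if_ mg' ig' fg; apply/lee_addgt0Pr => e e0.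
  (* Chosen so that [e' * m B <= e]; the added 1 keeps the denominator positive when [B] is null. *)
  pose e' := e / (fine (m B) + 1).
  have mB0 : 0 <= fine (m B) by exact: fine_ge0.
  have e'0 : 0 < e' by apply: divr_gt0 => //; lra.
  have ig'B : m.-integrable B (EFin \o g) by exact: integrableS ig'.
  have := @le_integral_unbounded f (g \- cst e') B mf if_ _ _ mB SB (fg _ e'0).
  have h1 : measurable_fun setT (g \- cst e').
    by apply: measurable_funB => //; exact: measurable_cst.
  have h2 : m.-integrable setT (EFin \o (g \- cst e')).
    exact: (integrableB measurableT ig' (integrable_cst e')).
  move=> /(_ h1 h2).
  rewrite (_ : (fun x => ((g \- cst e') x)%:E) = (fun x => (g x)%:E - (cst e' x)%:E)%E)//.
  rewrite integralB_EFin// (integral_cst m mB e'%:E) leeBlDr; last first.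
    by rewrite fin_numM// finite_measure_fin_num.
  move=> h; apply: le_trans h _; rewrite leeD2l//.
  rewrite -(fineK (finite_measure_fin_num _ mB)) -EFinM lee_fin /e' mulrAC.
  by rewrite ler_pdivrMr ?ler_pM2l//; lra.
apply/eqP; rewrite eq_le; apply/andP; split.
  apply: key => // e e0 x [_ Cx].
  apply/birkhoff_unbounded_exceeds => [i|]; first by rewrite /= birkhoff_lim_iter.
  by apply: lt_lim_exceeds_slope (birkhoff_limP _ _ _ Cx) _ => /=; lra.
have mN : measurable_fun setT (\- birkhoff_lim S F) by exact: measurableT_comp.
rewrite -leeN2.
rewrite -(integralN (integrable_add_def mB igB)) -(integralN (integrable_add_def mB iFB)).
apply: (key (\- F) (\- birkhoff_lim S F) mNF iNF mN (integrableN ig)) => e e0 x [_ Cx].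
apply/birkhoff_unboundedN => [i|]; first by rewrite /= birkhoff_lim_iter.
apply: (lt_lim_exceeds_slope _ _ (- birkhoff_lim S F x)); last by rewrite /=; lra.
rewrite (_ : (fun n => _) = (fun n => - birkhoff_avg S F n x)).
  by apply: cvgN; exact: birkhoff_limP.
by apply/funext => n; rewrite /birkhoff_avg mulrN.
Qed.

End limit.

End birkhoff_theorem.

(** * Invariance of the product measure under the skew product, and sections of null sets *)

Section skew_product.
Context {d1 d2} {T : measurableType d1} {Omega : measurableType d2} {R : realType}.
Context (mu : probability T R) (P : probability Omega R).
Context {K : countType} (tau : T -> T) (theta : K -> Omega -> Omega) (kappa : T -> K).

Definition skew_product (x : T * Omega) : T * Omega :=
  (tau x.1, theta (kappa x.1) x.2).

Hypothesis mtau : measurable_fun setT tau.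
Hypothesis mtheta : forall t, measurable_fun setT (theta (kappa t)).
Hypothesis mkappa : forall k, measurable (kappa @^-1` [set k]).

Lemma measurable_skew_product : measurable_fun setT skew_product.
Proof.
apply: measurable_fun_pair; first exact: measurableT_comp.
move=> _ A mA; rewrite setTI.
have -> : (fun x : T * Omega => theta (kappa x.1) x.2) @^-1` A =
    \bigcup_k ((kappa @^-1` [set k]) `*` (theta k @^-1` A)).
  apply/seteqP; split => [[t w] /= Atw|[t w] [k _] /= [<-]//].
  by exists (kappa t).
apply: countable_bigcupT_measurable => // k.
(* [theta k] is known to be measurable only for values [k] of [kappa]; for any other [k] the
   rectangle is empty. *)
have [kt|kt0] := pselect (exists t, kappa t = k).
  have [t <-] := kt; apply: measurableX => //.
  by rewrite -[_ @^-1` _]setTI; exact: mtheta.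
have -> : kappa @^-1` [set k] = set0; last by rewrite set0X; exact: measurable0.
by apply/seteqP; split => // t /= tk; case: kt0; exists t.
Qed.

Hypothesis ptau : forall A, measurable A -> mu (tau @^-1` A) = mu A.
Hypothesis ptheta : forall t A, measurable A -> P (theta (kappa t) @^-1` A) = P A.

(** The section at [t] of the preimage of [A] is the preimage under [theta (kappa t)] of the section
    of [A] at [tau t]: invariance of [P] removes [theta], then invariance of [mu] removes [tau]. *)
Lemma measure_preserving_skew_product : measure_preserving (mu \x P)%E skew_product.
Proof.
split=> [|A mA]; first exact: measurable_skew_product.
rewrite /= /product_measure1.
have -> : (P \o xsection (skew_product @^-1` A)) = (P \o xsection A) \o tau.
  apply/funext => t /=; rewrite -(ptheta t (xsection A (tau t))); last exact: measurable_xsection.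
  congr (P _); apply/seteqP; split => w /=; rewrite /xsection /= !inE //.
apply: (@ge0_integral_comp _ _ _ mu tau) => //.
exact: measurable_fun_xsection.
Qed.

End skew_product.

(** By uniqueness the product measure may be computed by integrating the measures of the sections in
    the other order; a nonnegative function with zero integral vanishes almost everywhere. *)
Lemma product_null_ysection_ae {d1 d2} {T1 : measurableType d1} {T2 : measurableType d2}
    {R : realType} (m1 : probability T1 R) (m2 : probability T2 R) (N : set (T1 * T2)) :
  measurable N -> (m1 \x m2)%E N = 0%E -> {ae m2, forall y, m1 (ysection N y) = 0%E}.
Proof.
move=> mN.
rewrite (product_measure_unique (m' := (m1 \x^ m2)%E))//; last first.
  by move=> A B mA mB; exact: product_measure2E.
rewrite /= /product_measure2 => N0.
have /ae_eq_integral_abs := measurable_fun_ysection m1 mN.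
move=> /(_ m2 measurableT)[+ _].
have -> : (\int[m2]_x `|(m1 \o ysection N) x| = 0)%E.
  by rewrite -N0; apply: eq_integral => y _; rewrite gee0_abs.
by move=> /(_ erefl); apply: filterS => y /(_ I).
Qed.

(** * From convergence on a dense set to uniform convergence *)

Section equicontinuous.
Context {R : realType} {M : pseudoPMetricType R} (a : nat -> M -> R).
Hypothesis equi : forall (t : M) (e : R), 0 < e -> exists2 del : R, 0 < del &
  forall (n : nat) (s : M), (0 < n)%N -> ball t del s -> `|a n t - a n s| < e.

(** Near [t] there is a point of convergence [s]; the values at [t] eventually stay within [e] of
    the limit at [s], hence form a Cauchy sequence. *)
Lemma equicontinuous_cvg :
  (forall U : set M, open U -> U !=set0 -> exists2 t, U t & cvgn (a ^~ t)) ->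
  forall t, cvgn (a ^~ t).
Proof.
move=> dense t; apply/cauchy_cvgP; apply: cauchy_exP => e e0.
have e2 : 0 < e / 2 by exact: divr_gt0.
have [del del0 Hdel] := equi t _ e2.
have [| |s ts /cvg_ex[l sl]] := dense (ball t del)°.
- exact: open_interior.
- by exists t; exact: nbhsx_ballx.
exists l; suff : \forall n \near \oo, `|l - a n t| < e by [].
near=> n.
have n0 : (0 < n)%N by near: n; exists 1%N.
have h1 := Hdel n s n0 (interior_subset ts).
have h2 : `|l - a n s| < e / 2 by near: n; move/cvgrPdist_lt : sl; exact.
rewrite [e]splitr; apply: le_lt_trans (ltrD h2 h1).
by rewrite (distrC (a n t)); exact: ler_distD.
Unshelve. all: by end_near. Qed.

Lemma equicontinuous_unif_cvg (g : M -> R) : compact [set: M] ->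
  (forall t, a n t @[n --> \oo] --> g t) ->
  ereal_sup [set (`|a n t - g t|)%:E | t in [set: M]] @[n --> \oo] --> 0%E.
Proof.
move=> cM ag.
have unif (e : R) : 0 < e -> \forall n \near \oo, forall t, `|a n t - g t| <= e.
  move=> e0; have e3 : 0 < e / 3 by exact: divr_gt0.
  have /compact_near_coveringP/(_ nat \oo (fun n t => `|a n t - g t| <= e)) := cM.
  move=> /(_ _ _)[|N N0 HN]; last by exists N => // n Nn t; exact: HN.
  move=> t _; have [del del0 Hdel] := equi t _ e3.
  (* The limit inherits the modulus of continuity, and three errors of [e / 3] then control a whole
     ball; compactness makes the threshold uniform. *)
  have gts s : ball t del s -> `|g t - g s| <= e / 3.
    move=> ts.
    have lts : `|a n t - a n s| @[n --> \oo] --> `|g t - g s|.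
      by apply: cvg_norm; apply: cvgB.
    apply: (cvgr_to_le lts).
    by near=> n; apply: ltW; apply: Hdel => //; near: n; exists 1%N.
  near=> s n => /=.
  have ts : ball t del s by near: s; exact: nbhsx_ballx.
  have n0 : (0 < n)%N by near: n; exists 1%N.
  have h1 := Hdel n s n0 ts.
  have h2 := gts s ts.
  have h3 : `|g t - a n t| < e / 3 by near: n; move/cvgrPdist_lt : (ag t); exact.
  have -> : a n s - g s = - (a n t - a n s) + - (g t - a n t) + (g t - g s) by ring.
  apply: le_trans (ler_normD _ _) _; apply: le_trans (lerD (ler_normD _ _) h2) _.
  by rewrite !normrN; lra.
have sup_le e : 0 < e -> \forall n \near \oo,
    (0 <= ereal_sup [set (`|a n t - g t|)%:E | t in [set: M]] <= e%:E)%E.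
  move=> e0; near=> n; apply/andP; split.
    (* A point of [M] keeps the supremum from being that of the empty set. *)
    apply: (@le_trans _ _ `|a n point - g point|%:E); first by rewrite lee_fin.
    by apply: ereal_sup_ubound; exists point.
  apply: ge_ereal_sup => _ [t _ <-]; rewrite lee_fin.
  by move: t; near: n; exact: unif.
apply/fine_cvgP; split.
  near=> n; have : (0 <= ereal_sup [set (`|a n t - g t|)%:E | t in [set: M]] <= 1%:E)%E.
    by near: n; exact: sup_le.
  by case/andP => h0 h1; rewrite ge0_fin_numE// (le_lt_trans h1)// ltry.
apply/cvgrPdist_le => e e0; near=> n.
have : (0 <= ereal_sup [set (`|a n t - g t|)%:E | t in [set: M]] <= e%:E)%E.
  by near: n; exact: sup_le.
rewrite sub0r normrN /=; set u := ereal_sup _; case: u => [r| |] //=.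
  by rewrite !lee_fin => /andP[r0 re]; rewrite ger0_norm.
by rewrite normr0 (ltW e0).
Unshelve. all: by end_near. Qed.

End equicontinuous.

(** * Uniform convergence for the skew product *)

Lemma continuous_measurable_borel {M : ptopologicalType} (f : M -> M) :
  continuous f -> measurable_fun setT (f : borel_of M -> borel_of M).
Proof.
move=> cf; apply: (@measurability _ _ (borel_of M) (borel_of M) setT f (@open M)) => //.
move=> _ [A oA <-]; rewrite setTI; apply: sub_sigma_algebra.
by apply: open_comp => // x _; exact: cf.
Qed.

Lemma Kset_sum (grp : bool) (d n : nat) (k : 'I_n -> 'rV[int]_d) :
  (forall i, Kset grp (k i)) -> Kset grp (\sum_(i < n) k i).
Proof.
rewrite /Kset; case: grp => //= k0 j; rewrite summxE.
by apply: sumr_ge0 => i _; exact: k0.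
Qed.

(** A conditional expectation is determined only up to null sets, while the supremum sees every [t];
    hence a version [g] is provided. In the group case the composition law already makes
    [theta (- k)] inverse to [theta k]. *)
Theorem theorem4p11 (R : realType) (d : nat) (grp : bool)
  (dO : measure_display) (Omega : measurableType dO) (P : probability Omega R)
  (theta : 'rV[int]_d -> Omega -> Omega)
  (M : pseudoPMetricType R)
  (tau : M -> M) (mu : probability (borel_of M) R)
  (kappa : M -> 'rV[int]_d)
  (F : borel_of M * Omega -> R) :
  (* semigroup (group if grp) of P-preserving transformations *)
  (forall k, Kset grp k -> measurable_fun setT (theta k) /\
     forall A, measurable A -> P (theta k @^-1` A) = P A) ->
  theta 0 = id ->
  (forall k l, Kset grp k -> Kset grp l -> theta k \o theta l = theta (k + l)) ->
  (* M compact separable metric space *)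
  hausdorff_space M ->
  compact [set: M] ->
  (exists D : set M, countable D /\ closure D = setT) ->
  (* tau continuous, mu tau-invariant with full support *)
  continuous tau ->
  (forall A : set (borel_of M), measurable A -> mu (tau @^-1` A) = mu A) ->
  (forall U : set M, open U -> U !=set0 -> (0 < mu U)%E) ->
  (* kappa measurable with values in K *)
  (forall t, Kset grp (kappa t)) ->
  (forall k, measurable (kappa @^-1` [set k] : set (borel_of M))) ->
  (* F measurable, integrable, with integrable sections *)
  measurable_fun setT F ->
  (mu \x P)%E.-integrable setT (EFin \o F) ->
  (forall t : M, P.-integrable setT (fun w => (F (t, w))%:E)) ->
  let kappa_n (n : nat) (t : M) := \sum_(i < n) kappa (iter i tau t) in
  let avg (n : nat) (t : M) (w : Omega) :=
    (n%:R)^-1 * \sum_(i < n) F (iter i tau t, theta (kappa_n i t) w) in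
  let S (x : borel_of M * Omega) : borel_of M * Omega :=
    (tau x.1, theta (kappa x.1) x.2) in
  (* equicontinuity for every omega *)
  (forall w (t : M) (e : R), 0 < e -> exists2 del : R, 0 < del &
     forall (n : nat) (s : M), (0 < n)%N -> ball t del s ->
       `|avg n t w - avg n s w| < e) ->
  exists g : borel_of M * Omega -> R,
    is_cond_exp (mu \x P)%E (invariant_sets S) F g /\
    {ae P, forall w,
      (fun n => ereal_sup [set (`|avg n t w - g (t, w)|)%:E | t in [set: M]])
        @ \oo --> 0%E}.
Proof.
move=> theta_mp theta0 thetaD _ cM _ ctau ptau mu_pos Kkappa mkappa mF iF _.
move=> kappa_n avg S equi.
have mpS : measure_preserving (mu \x P)%E S.
  apply: (@measure_preserving_skew_product _ _ _ _ R mu P _ tau theta kappa) => //.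
  - exact: continuous_measurable_borel.
  - by move=> t; exact: (theta_mp _ (Kkappa t)).1.
  - by move=> t A; exact: (theta_mp _ (Kkappa t)).2.
have finm : ((mu \x P)%E setT < +oo)%E.
  have := product_measure1E mu P measurableT measurableT; rewrite setXTT => ->.
  rewrite -ge0_fin_numE ?mule_ge0//; apply: fin_numM; exact: fin_num_measure.
(* The cocycle identity: it turns the given averages into Birkhoff averages of [S]. *)
have iterS i t w : iter i S (t, w) = (iter i tau t, theta (kappa_n i t) w).
  elim: i => [|i IHi] /=; first by rewrite /kappa_n big_ord0 theta0.
  rewrite IHi /S /= -[theta _ (theta _ _)]/((theta _ \o theta _) w) thetaD//.
    by rewrite /kappa_n big_ord_recr /= addrC.
  by apply: Kset_sum.
have avgE n t w : avg n t w = birkhoff_avg S F n (t, w).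
  by rewrite /avg /birkhoff_avg /birkhoff_sum; under [in RHS]eq_bigr do rewrite iterS.
exists (birkhoff_lim S F); split; first exact: birkhoff_cond_exp.
have mN := measurableC (measurable_birkhoff_cvg (mu \x P)%E S mpS F mF).
have := product_null_ysection_ae mu P _ mN (birkhoff_cvg_ae (mu \x P)%E S mpS finm F mF iF).
apply: filterS => w Nw.
have cv : forall t, cvgn (fun n => avg n t w).
  apply: (equicontinuous_cvg (fun n t => avg n t w)) => [t e e0|U oU U0]; first exact: equi.
  (* An open set without a point of convergence would lie in the null section of the set of
     divergence. *)
  apply: contrapT => nU; have := mu_pos U oU U0; rewrite lt0e => /andP[/eqP + _]; apply.
  apply: (subset_measure0 _ _ _ Nw).
  - exact: sub_sigma_algebra.
  - exact: measurable_ysection.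
  - move=> t Ut; apply/ysectionP => Ct; apply: nU; exists t => //.
    by under eq_fun do rewrite avgE.
apply: equicontinuous_unif_cvg => // t; first exact: equi.
(* For such [w] the averages converge at every [t], so [birkhoff_lim] is a true limit there and
   never the default value. *)
have Ct : birkhoff_cvg S F (t, w) by move: (cv t); under eq_fun do rewrite avgE.
by move: (birkhoff_limP _ _ _ Ct); under eq_fun do rewrite -avgE.
Qed.
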